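(* Let $f\colon M^{2n}\to\mathbb{H}^{2n+p}$, $2\leq p\leq n-2$, be an isometric immersion of a Kaehler manifold of real dimension $2n$. If the weak maximum principle for the Hessian holds on $M^{2n}$, then $f(M)$ is unbounded.
   Context: $\mathbb{H}^{N}$ denotes the $N$-dimensional hyperbolic space of constant sectional curvature $-1$; a subset is unbounded if it is not contained in any geodesic ball. The weak maximum principle for the Hessian is said to hold on a Riemannian manifold $M$ if for any function $g\in C^2(M)$ with $g^*=\sup_M g<+\infty$ there exists a sequence of points $\{x_k\}_{k\in\mathbb{N}}$ in $M$ such that, for every $k$, (i) $g(x_k)>g^*-1/k$, and (ii) $\mathrm{Hess}\, g(x_k)(X,X)\leq (1/k)\|X\|^2$ for all $X\in T_{x_k}M$. Isometric immersions are isometric only for the Riemannian metrics. *)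

(* Defs.v *)
From mathcomp Require Import all_boot all_order all_algebra.
From mathcomp Require Import all_classical all_reals all_analysis.

Set Implicit Arguments.
Unset Strict Implicit.
Unset Printing Implicit Defensive.

Import Order.TTheory GRing.Theory Num.Theory.
Import numFieldNormedType.Exports.

Local Open Scope classical_set_scope.
Local Open Scope ring_scope.

Section Calculus.
Context {R : realType} {m : nat} {V : normedModType R}.

Definition partial (i : 'I_m) (F : 'rV[R]_m -> V) : 'rV[R]_m -> V :=
  fun u => 'D_(delta_mx 0 i) F u.

(* F is of class C^k on U; meant for open U, on which the partial derivatives
   of F depend only on the restriction of F to U. *)
Fixpoint class_C (k : nat) (U : set 'rV[R]_m) (F : 'rV[R]_m -> V) : Prop :=
  {within U, continuous F} /\
  if k is k'.+1 then
    forall i : 'I_m, (forall u, U u -> derivable F u (delta_mx 0 i)) /\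
                     class_C k' U (partial i F)
  else True.

Definition smooth (U : set 'rV[R]_m) (F : 'rV[R]_m -> V) : Prop :=
  forall k, class_C k U F.

End Calculus.

(* coord and param are total functions; only their values on dom and cod,
   where they are mutually inverse homeomorphisms, are meaningful. *)
Record chart (R : realType) (T : topologicalType) (m : nat) := Chart {
  dom : set T;
  cod : set 'rV[R]_m;
  coord : T -> 'rV[R]_m;
  param : 'rV[R]_m -> T;
  dom_open : open dom;
  cod_open : open cod;
  coord_cod : forall x, dom x -> cod (coord x);
  param_dom : forall u, cod u -> dom (param u);
  coordK : forall x, dom x -> param (coord x) = x;
  paramK : forall u, cod u -> coord (param u) = u;
  coord_continuous : {within dom, continuous coord};
  param_continuous : {within cod, continuous param}
}.

Definition overlap (R : realType) (T : topologicalType) (m : nat)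
    (a b : chart R T m) : set 'rV[R]_m :=
  [set u | cod a u /\ dom b (param a u)].

Definition transition (R : realType) (T : topologicalType) (m : nat)
    (a b : chart R T m) : 'rV[R]_m -> 'rV[R]_m :=
  coord b \o param a.

(* Smooth m-manifolds, not assumed connected. *)
Record smoothManifold (R : realType) (m : nat) := SmoothManifold {
  points :> topologicalType;
  points_hausdorff : hausdorff_space points;
  points_second_countable : @second_countable points;
  atlas_index : Type;
  atlas : atlas_index -> chart R points m;
  atlas_cover : forall x : points, exists a, dom (atlas a) x;
  atlas_smooth : forall a b,
    smooth (overlap (atlas a) (atlas b)) (transition (atlas a) (atlas b))
}.

(* Tensor fields are given by their components in the charts of the atlas,
   subject to the transformation laws.  A tangent vector is represented in a
   chart by a row vector X, so the differential of F at u is X |-> X *m 'J F u,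
   and gram a u i j = g(d_i, d_j). *)
Record riemannianManifold (R : realType) (m : nat) := RiemannianManifold {
  manifold :> smoothManifold R m;
  gram : atlas_index manifold -> 'rV[R]_m -> 'M[R]_m;
  gram_smooth : forall a, smooth (cod (atlas a)) (gram a);
  gram_sym : forall a u, cod (atlas a) u -> (gram a u)^T = gram a u;
  gram_posdef : forall a u (X : 'rV[R]_m), cod (atlas a) u -> X != 0 ->
    0 < (X *m gram a u *m X^T) 0 0;
  gram_transition : forall a b u, overlap (atlas a) (atlas b) u ->
    let t := transition (atlas a) (atlas b) in
    gram a u = jacobian t u *m gram b (t u) *m (jacobian t u)^T
}.

Section Riemannian.
Context {R : realType} {m : nat} (M : riemannianManifold R m).
Implicit Types (a : atlas_index M) (u : 'rV[R]_m).

Definition metric a u (X Y : 'rV[R]_m) : R := (X *m gram a u *m Y^T) 0 0.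

(* Gamma^k_ij *)
Definition christoffel a u (i j k : 'I_m) : R :=
  2^-1 * \sum_(l < m) invmx (gram a u) k l *
    (partial i (gram a) u j l + partial j (gram a) u i l
     - partial l (gram a) u i j).

Definition C2_function (h : M -> R) : Prop :=
  forall a, class_C 2 (cod (atlas a)) (h \o param (atlas a)).

Definition hessian (h : M -> R) a u : 'M[R]_m :=
  let ha := h \o param (atlas a) in
  \matrix_(i, j) (partial i (partial j ha) u
                  - \sum_(k < m) christoffel a u i j k * partial k ha u).

Definition weak_maximum_principle_hessian : Prop :=
  forall h : M -> R, C2_function h -> has_ubound (range h) ->
  exists x : nat -> M, forall k : nat, (0 < k)%N ->
    sup (range h) - k%:R^-1 < h (x k) /\
    forall a, dom (atlas a) (x k) -> forall X : 'rV[R]_m,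
      let u := coord (atlas a) (x k) in
      (X *m hessian h a u *m X^T) 0 0 <= k%:R^-1 * metric a u X X.

(* For a field A of endomorphisms, A d_i = \sum_j A i j d_j, this is the
   component (nabla_{d_k} A)_i^j. *)
Definition nabla_endo a (A : 'rV[R]_m -> 'M[R]_m) u (k i j : 'I_m) : R :=
  partial k A u i j
  + \sum_(l < m) (A u i l * christoffel a u k l j
                  - christoffel a u k i l * A u l j).

End Riemannian.

(* A Riemannian manifold with an orthogonal almost complex structure that is
   parallel for the Levi-Civita connection; cplx acts by X |-> X *m cplx a u. *)
Record kaehlerManifold (R : realType) (n : nat) := KaehlerManifold {
  riemannian :> riemannianManifold R (2 * n);
  cplx : atlas_index riemannian -> 'rV[R]_(2 * n) -> 'M[R]_(2 * n);
  cplx_smooth : forall a, smooth (cod (atlas a)) (cplx a);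
  cplx_transition : forall a b u, overlap (atlas a) (atlas b) u ->
    let t := transition (atlas a) (atlas b) in
    cplx a u *m jacobian t u = jacobian t u *m cplx b (t u);
  cplx_square : forall a u, cod (atlas a) u -> cplx a u *m cplx a u = - 1%:M;
  cplx_orthogonal : forall a u (X Y : 'rV[R]_(2 * n)), cod (atlas a) u ->
    metric a u (X *m cplx a u) (Y *m cplx a u) = metric a u X Y;
  cplx_parallel : forall a u k i j, cod (atlas a) u ->
    nabla_endo a (cplx a) u k i j = 0
}.

Section Hyperbolic.
Context {R : realType} {N : nat}.

Definition lorentz (x y : 'rV[R]_N.+1) : R :=
  \sum_(i < N) x 0 (lift ord0 i) * y 0 (lift ord0 i) - x 0 0 * y 0 0.

End Hyperbolic.

(* The hyperboloid model; its Riemannian metric (of constant curvature -1) is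
   the restriction of the Lorentz form to the tangent spaces. *)
Record hyperbolic (R : realType) (N : nat) := Hyperbolic {
  ambient :> 'rV[R]_N.+1;
  ambient_norm : lorentz ambient ambient = - 1;
  ambient_sheet : 0 < ambient 0 0
}.

Definition arcosh {R : realType} (a : R) : R := ln (a + Num.sqrt (a ^+ 2 - 1)).

Definition hyperbolic_dist {R : realType} {N : nat} (x y : hyperbolic R N) : R :=
  arcosh (- lorentz x y).

Definition geodesic_ball {R : realType} {N : nat} (o : hyperbolic R N) (r : R) :
    set (hyperbolic R N) :=
  [set x | hyperbolic_dist o x < r].

Definition unbounded {R : realType} {N : nat} (A : set (hyperbolic R N)) : Prop :=
  ~ exists (o : hyperbolic R N) (r : R), A `<=` geodesic_ball o r.

(* Smoothness and the differential are those of f as a map into R^(N+1), in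
   which the hyperboloid is embedded.  Injectivity of the differential follows
   from the positive definiteness of the metric of M. *)
Definition isometric_immersion {R : realType} {m N : nat}
    (M : riemannianManifold R m) (f : M -> hyperbolic R N) : Prop :=
  forall a : atlas_index M,
    let fa := fun u : 'rV[R]_m => ambient (f (param (atlas a) u)) in
    smooth (cod (atlas a)) fa /\
    forall u (X Y : 'rV[R]_m), cod (atlas a) u ->
      lorentz ('D_X fa u) ('D_Y fa u) = metric a u X Y.

(* Main.v *)
Require Import Defs.
From mathcomp Require Import all_boot all_order all_algebra.
From mathcomp Require Import all_classical all_reals all_analysis.
From mathcomp Require Import ring lra zify.

(** The hyperbolic space is a hyperboloid in a flat Lorentz space.  Let [alpha] be
    the second fundamental form of the immersion into that flat space; it has values
    in a normal space of dimension [p + 1] containing the position vector [f], and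
    the product of [alpha X X] with [f] is [- |X|^2].

    Algebra at a point.  The Kaehler condition and the Gauss equation make
    [gamma X Y = (alpha X Y, alpha X (J Y))] a flat bilinear form for the split
    product on two copies of the normal space ([second_form_flat]).  These two copies
    have dimension [2 (p + 1)], less than the dimension [2 n] of the tangent space,
    and a standard argument on flat forms, with a vector [Z] for which the rank of
    [gamma Z] is maximal, yields [W != 0] such that
    [b = alpha W W + alpha (J W) (J W)] is a null vector ([exists_null_value],
    [exists_null_direction]).  Its product with [f] is [- 2 |W|^2], so [b] is a
    nonzero future-directed light ray.

    Geometry.  Suppose that the image lies in a ball of centre [o].  The height
    [h = - <f, o>], the hyperbolic cosine of the distance to [o], is bounded, and
    its Hessian is [- <alpha, o>] ([hessian_height]).  At a point given by the
    maximum principle, adding the inequalities for [W] and [J W] yields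
    [- <b, o> <= (2 / k) |W|^2].  But [b] is a light ray and [o] is at bounded
    distance from [f], so [- <b, o>] is bounded below by a fixed multiple of
    [- <b, f> = 2 |W|^2] ([null_observer_bound]), a contradiction for large [k].

    All derivatives are partial derivatives in one chart.  The Gauss equation is
    obtained by comparing the coordinate frame with its image under [J], which has
    the same metric and the same connection coefficients ([gauss_equation]); this
    uses only the symmetry of second derivatives ([partial_mxC]). *)

Set Implicit Arguments.
Unset Strict Implicit.
Unset Printing Implicit Defensive.

Import Order.TTheory GRing.Theory Num.Theory.
Import numFieldNormedType.Exports.

Local Open Scope classical_set_scope.
Local Open Scope ring_scope.

(** * Maps of class C^k on an open set *)

Section Calculus.
Context {R : realType} {m : nat}.
Implicit Types (U : set 'rV[R]_m) (u : 'rV[R]_m).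

Section General.
Context {V : normedModType R}.
Implicit Types (F G : 'rV[R]_m -> V).

Lemma class_C_continuous d U F u :
  open U -> class_C d U F -> U u -> {for u, continuous F}.
Proof.
move=> oU CF Uu; have {CF} : {within U, continuous F} by case: d CF => [|d] [].
by rewrite continuous_open_subspace // => /(_ u); apply; rewrite inE.
Qed.

Lemma continuous_class_C0 U F :
  open U -> (forall u, U u -> {for u, continuous F}) -> {within U, continuous F}.
Proof.
move=> oU cF; rewrite continuous_open_subspace // => u; rewrite inE; exact: cF.
Qed.

Lemma class_C_derivable d U F u i :
  class_C d.+1 U F -> U u -> derivable F u (delta_mx 0 i).
Proof. by move=> [_ /(_ i)[dF _]]; exact: dF. Qed.

Lemma class_C_partial d U F i : class_C d.+1 U F -> class_C d U (partial i F).
Proof. by move=> [_ /(_ i)[]]. Qed.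

Lemma class_CW d U F : class_C d.+1 U F -> class_C d U F.
Proof.
elim: d F => [F [cF _] //|d IHd F [cF dF]]; split=> // i.
by have [? ?] := dF i; split=> //; exact: IHd.
Qed.

Lemma class_C_le d e U F : (d <= e)%N -> class_C e U F -> class_C d U F.
Proof.
move=> /subnK <-; elim: (e - d)%N => // k IHk; rewrite addSn => /class_CW; exact: IHk.
Qed.

Lemma partial_ext U F G u i :
  open U -> {in U, F =1 G} -> U u -> partial i F u = partial i G u.
Proof.
move=> oU FG Uu; apply: near_eq_derive; near=> v; apply: FG; rewrite inE.
by near: v; exact: open_nbhs_nbhs.
Unshelve. all: by end_near. Qed.

(** Only the values on [U] matter because [U] is open; this lets the algebraic
    rules below be applied to derivatives that are computed on [U] only. *)
Lemma class_C_ext d U F G :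
  open U -> {in U, F =1 G} -> class_C d U F -> class_C d U G.
Proof.
move=> oU.
have near_FG (F1 G1 : 'rV[R]_m -> V) u : {in U, F1 =1 G1} -> U u ->
    \forall v \near u, F1 v = G1 v.
  move=> FG Uu; near=> v; apply: FG; rewrite inE.
  by near: v; exact: open_nbhs_nbhs.
have cont_FG (F1 G1 : 'rV[R]_m -> V) : {in U, F1 =1 G1} ->
    {within U, continuous F1} -> {within U, continuous G1}.
  move=> FG; rewrite !continuous_open_subspace // => cF u Uu.
  have := cF u Uu; rewrite /continuous_at -(FG u Uu).
  apply: cvg_trans.
  rewrite inE in Uu; exact: near_eq_cvg (near_FG _ _ _ FG Uu).
elim: d F G => [|d IHd] F G FG [cF dF]; split => //; first exact: cont_FG cF.
  exact: cont_FG cF.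
move=> i; have [dFi CFi] := dF i; split=> [u Uu|].
  by apply: near_eq_derivable (dFi u Uu); exact: near_FG.
apply: IHd CFi => u; rewrite inE => Uu; exact: partial_ext Uu.
Unshelve. all: by end_near. Qed.

Lemma class_C_cst d U (c : V) : open U -> class_C d U (fun=> c).
Proof.
move=> oU; elim: d c => [|d IHd] c; split=> //.
- by apply: continuous_class_C0 => // u _; exact: cst_continuous.
- by apply: continuous_class_C0 => // u _; exact: cst_continuous.
- move=> i; split=> [u _|]; first exact: derivable_cst.
  apply: (@class_C_ext d U (fun=> 0)) => // u _.
  by rewrite /partial derive_cst.
Qed.

Lemma partialD d U F G u i : class_C d.+1 U F -> class_C d.+1 U G -> U u ->
  partial i (fun v => F v + G v) u = partial i F u + partial i G u.
Proof.
move=> CF CG Uu; apply: deriveD; by apply: class_C_derivable Uu; eassumption.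
Qed.

Lemma class_C_add d U F G : open U ->
  class_C d U F -> class_C d U G -> class_C d U (fun u => F u + G u).
Proof.
move=> oU; elim: d F G => [|d IHd] F G CF CG; split=> //.
- apply: continuous_class_C0 => // u Uu.
  exact: cvgD (class_C_continuous oU CF Uu)
    (class_C_continuous oU CG Uu).
- apply: continuous_class_C0 => // u Uu.
  exact: cvgD (class_C_continuous oU CF Uu)
    (class_C_continuous oU CG Uu).
- move=> i; split=> [u Uu|].
    by apply: derivableD; by apply: class_C_derivable Uu; eassumption.
  apply: (@class_C_ext d U (fun u => partial i F u + partial i G u)) => //.
    by move=> u; rewrite inE => Uu; rewrite (partialD _ CF CG).
  by apply: IHd; exact: class_C_partial.
Qed.

End General.

Lemma partialM d U (F G : 'rV[R]_m -> R) u i :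
  class_C d.+1 U F -> class_C d.+1 U G -> U u ->
  partial i (fun v => F v * G v) u = partial i F u * G u + F u * partial i G u.
Proof.
move=> CF CG Uu; rewrite /partial.
rewrite (@deriveM _ _ F G); try by apply: class_C_derivable Uu; eassumption.
by rewrite addrC mulrC.
Qed.

Lemma class_C_mul d U (F G : 'rV[R]_m -> R) : open U ->
  class_C d U F -> class_C d U G -> class_C d U (fun u => F u * G u).
Proof.
move=> oU; elim: d F G => [|d IHd] F G CF CG; split=> //.
- apply: continuous_class_C0 => // u Uu.
  exact: cvgM (class_C_continuous oU CF Uu)
    (class_C_continuous oU CG Uu).
- apply: continuous_class_C0 => // u Uu.
  exact: cvgM (class_C_continuous oU CF Uu)
    (class_C_continuous oU CG Uu).
- move=> i; split=> [u Uu|].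
    by apply: (@derivableM _ _ F G); by apply: class_C_derivable Uu; eassumption.
  apply: (@class_C_ext _ d U (fun u => partial i F u * G u + F u * partial i G u)) => //.
    by move=> u; rewrite inE => Uu; rewrite (partialM _ CF CG).
  by apply: class_C_add => //; apply: IHd => //;
    first [exact: class_C_partial | exact: class_CW].
Qed.

Lemma class_C_sum d U (I : Type) (r : seq I) (F : I -> 'rV[R]_m -> R) : open U ->
  (forall l, class_C d U (F l)) -> class_C d U (fun u => \sum_(l <- r) F l u).
Proof.
move=> oU CF; elim: r => [|l r IHr].
  by apply: (class_C_ext oU _ (class_C_cst d 0 oU)) => u _; rewrite big_nil.
by apply: (class_C_ext oU _ (class_C_add oU (CF l) IHr)) => u _; rewrite big_cons.
Qed.

Lemma partial_sum d U (I : Type) (r : seq I) (F : I -> 'rV[R]_m -> R) u i : open U ->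
  (forall l, class_C d.+1 U (F l)) -> U u ->
  partial i (fun v => \sum_(l <- r) F l v) u = \sum_(l <- r) partial i (F l) u.
Proof.
move=> oU CF Uu; elim: r => [|l r IHr].
  rewrite big_nil (@partial_ext _ U _ (fun=> 0)) //; first exact: derive_cst.
  by move=> v _; rewrite big_nil.
rewrite big_cons -IHr -(partialD _ (CF l) (class_C_sum r oU CF) Uu).
by apply: (partial_ext _ oU) => // v _; rewrite big_cons.
Qed.

Section Matrices.
Context {p q : nat}.
Implicit Types F : 'rV[R]_m -> 'M[R]_(p, q).

Lemma partial_mx F u k i j : derivable F u (delta_mx 0 k) ->
  partial k F u i j = partial k (fun v => F v i j) u.
Proof. by move=> dF; rewrite /partial derive_mx // mxE. Qed.

Lemma mx_continuous F u :
  (forall i j, {for u, continuous (fun v => F v i j)}) -> {for u, continuous F}.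
Proof.
move=> cF; apply/(@cvgrPdist_le _ _ _ (nbhs u)) => e e0; near=> v.
rewrite /Num.Def.normr/= mx_normrE (bigmax_le _ (ltW e0))//= => i _.
rewrite !mxE/=.
move: i; near: v; apply: filter_forall => /= i.
exact: ((cvgrPdist_le _ _).1 (cF i.1 i.2)).
Unshelve. all: by end_near. Qed.

(** Matrix-valued maps are handled entrywise: the product rule then reduces to
    the one for real functions, and no bilinear calculus is needed. *)
Lemma class_C_mxP d U F : open U ->
  class_C d U F <-> forall i j, class_C d U (fun u => F u i j).
Proof.
move=> oU; elim: d F => [|d IHd] F; split.
- move=> CF i j; split=> //; apply: continuous_class_C0 => // u Uu.
  apply: (@continuous_comp _ _ _ F (fun M : 'M[R]_(p, q) => M i j)).
    exact: class_C_continuous oU CF Uu.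
  exact: coord_continuous.
- move=> CF; split=> //; apply: continuous_class_C0 => // u Uu.
  by apply: mx_continuous => i j; exact: class_C_continuous oU (CF i j) Uu.
- move=> CF i j; split.
    apply: continuous_class_C0 => // u Uu.
    apply: (@continuous_comp _ _ _ F (fun M : 'M[R]_(p, q) => M i j)).
      exact: class_C_continuous oU CF Uu.
    exact: coord_continuous.
  move=> k; split=> [u Uu|].
    have dF := class_C_derivable (i := k) CF Uu; move/derivable_mxP: dF; exact.
  have /(IHd _).1 /(_ i j) := class_C_partial k CF.
  apply: class_C_ext => // u; rewrite inE => Uu; rewrite partial_mx //.
  by apply: class_C_derivable Uu; eassumption.
- move=> CF; split.
    apply: continuous_class_C0 => // u Uu.
    by apply: mx_continuous => i j; exact: class_C_continuous oU (CF i j) Uu.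
  have dF u k : U u -> derivable F u (delta_mx 0 k).
    by move=> Uu; apply/derivable_mxP => i j; exact: class_C_derivable (CF i j) Uu.
  move=> k; split=> [u|]; first exact: dF.
  apply/IHd => i j; apply: class_C_ext (class_C_partial k (CF i j)) => //.
  by move=> u; rewrite inE => Uu; rewrite partial_mx //; exact: dF.
Qed.

End Matrices.

Lemma class_C_mulmx d U p q r (F : 'rV[R]_m -> 'M[R]_(p, q))
    (G : 'rV[R]_m -> 'M[R]_(q, r)) : open U ->
  class_C d U F -> class_C d U G -> class_C d U (fun u => F u *m G u).
Proof.
move=> oU /(class_C_mxP _ _ oU) CF /(class_C_mxP _ _ oU) CG.
apply/class_C_mxP => // i j.
apply: class_C_ext (class_C_sum (index_enum _) oU
  (fun l => class_C_mul oU (CF i l) (CG l j))) => // u _.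
by rewrite mxE.
Qed.

Lemma class_C_trmx d U p q (F : 'rV[R]_m -> 'M[R]_(p, q)) : open U ->
  class_C d U F -> class_C d U (fun u => (F u)^T).
Proof.
move=> oU /(class_C_mxP _ _ oU) CF; apply/class_C_mxP => // i j.
by apply: class_C_ext (CF j i) => // u _; rewrite mxE.
Qed.

Lemma partial_mulmx U p q r (F : 'rV[R]_m -> 'M[R]_(p, q))
    (G : 'rV[R]_m -> 'M[R]_(q, r)) k u : open U ->
  class_C 1 U F -> class_C 1 U G -> U u ->
  partial k (fun v => F v *m G v) u = partial k F u *m G u + F u *m partial k G u.
Proof.
move=> oU CF CG Uu; apply/matrixP => i j.
have /(class_C_mxP _ _ oU) CF' := CF; have /(class_C_mxP _ _ oU) CG' := CG.
rewrite partial_mx; last exact: class_C_derivable (class_C_mulmx oU CF CG) Uu.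
rewrite !mxE -big_split /=.
transitivity (partial k (fun v => \sum_l F v i l * G v l j) u).
  by apply: (partial_ext _ oU) => // v _; rewrite mxE.
rewrite (partial_sum _ (d := 0) (U := U)) //; last by move=> l; exact: class_C_mul.
apply: eq_bigr => l _; rewrite (partialM _ (CF' i l) (CG' l j) Uu).
by rewrite !partial_mx //; by apply: class_C_derivable Uu; eassumption.
Qed.

Lemma partial_trmx U p q (F : 'rV[R]_m -> 'M[R]_(p, q)) k u : open U ->
  class_C 1 U F -> U u -> partial k (fun v => (F v)^T) u = (partial k F u)^T.
Proof.
move=> oU CF Uu; apply/matrixP => i j; rewrite mxE.
rewrite partial_mx; last exact: class_C_derivable (class_C_trmx oU CF) Uu.
rewrite partial_mx; last exact: class_C_derivable CF Uu.
by apply: (partial_ext _ oU) => // v _; rewrite mxE.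
Qed.

End Calculus.

(** * Symmetry of second derivatives *)

Section Schwarz.
Context {R : realType} {m : nat}.
Implicit Types (U : set 'rV[R]_m) (u v w : 'rV[R]_m) (phi : 'rV[R]_m -> R).

Lemma is_derive_line phi v w (s : R) : derivable phi (s *: v + w) v ->
  is_derive s (1 : R) (fun t => phi (t *: v + w)) ('D_v phi (s *: v + w)).
Proof.
have E : (fun h : R => h^-1 *: (((fun t : R => phi (t *: v + w)) \o shift s) (h *: (1 : R))
            - phi (s *: v + w)))
       = (fun h : R => h^-1 *: ((phi \o shift (s *: v + w)) (h *: v) - phi (s *: v + w))).
  apply/funext => h /=; rewrite addrA -scalerDl.
  by congr (_ *: (phi (_ *: v + w) - _)); rewrite [h *: 1]mulr1.
by move=> dphi; split; rewrite /derivable /derive E.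
Qed.

Lemma MVT_line phi v w (e : R) : 0 <= e ->
  (forall s, 0 <= s <= e -> derivable phi (s *: v + w) v) ->
  exists2 s, 0 <= s <= e & phi (e *: v + w) - phi w = e * 'D_v phi (s *: v + w).
Proof.
move=> e0 dphi.
have dline s : s \in `[0, e] -> is_derive s (1 : R) (fun t => phi (t *: v + w))
    ('D_v phi (s *: v + w)).
  by rewrite in_itv /= => sI; apply: is_derive_line; exact: dphi.
have cline : {within `[0, e], continuous (fun t : R => phi (t *: v + w))}.
  by apply: derivable_within_continuous => s sI; have [] := dline s sI.
have dline_oo s : s \in `]0, e[ -> is_derive s (1 : R) (fun t => phi (t *: v + w))
    ('D_v phi (s *: v + w)).
  by move=> sI; apply: dline; exact: subset_itv_oo_cc sI.
have [s] := MVT_segment e0 dline_oo cline.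
rewrite in_itv /= => sI; rewrite scale0r add0r subr0 mulrC => E.
by exists s.
Qed.

(** Two applications of the mean value theorem, in the direction [i] and then in
    the direction [j], to the increment of [phi] over the corners of a square of
    side [e].  The left-hand side is symmetric in [i] and [j]. *)
Lemma second_difference phi U u i j (e : R) : open U -> class_C 2 U phi -> 0 <= e ->
  let vi := delta_mx 0 i in let vj := delta_mx 0 j in
  (forall s t, 0 <= s <= e -> 0 <= t <= e -> U (s *: vi + (t *: vj + u))) ->
  exists s t, [/\ 0 <= s <= e, 0 <= t <= e &
    phi (e *: vi + (e *: vj + u)) - phi (e *: vi + u) - phi (e *: vj + u) + phi u
    = e * (e * partial j (partial i phi) (s *: vi + (t *: vj + u)))].
Proof.
move=> oU Cphi e0 vi vj sqU.
have e_in : 0 <= e <= e by rewrite e0 lexx.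
have z_in : 0 <= (0 : R) <= e by rewrite e0 lexx.
pose psi x := phi (x + e *: vj) - phi x.
have U0 s : 0 <= s <= e -> U (s *: vi + u).
  by move=> sI; have := sqU s 0 sI z_in; rewrite scale0r add0r.
have shift_phi s : 0 <= s <= e ->
    is_derive (s *: vi + u) vi (fun x => phi (x + e *: vj))
      (partial i phi (s *: vi + u + e *: vj)).
  move=> sI.
  have E : (fun h : R => h^-1 *:
          (((fun x => phi (x + e *: vj)) \o shift (s *: vi + u)) (h *: vi)
           - phi (s *: vi + u + e *: vj)))
      = (fun h : R => h^-1 *:
          ((phi \o shift (s *: vi + u + e *: vj)) (h *: vi)
           - phi (s *: vi + u + e *: vj))).
    by apply/funext => h /=; rewrite !addrA.
  have d : derivable phi (s *: vi + u + e *: vj) vi.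
    apply: (class_C_derivable (i := i) Cphi); rewrite -addrA [u + _]addrC.
    exact: sqU.
  by split; [move: d|]; rewrite /partial /derivable /derive E.
have dphi s : 0 <= s <= e -> derivable phi (s *: vi + u) vi.
  by move=> sI; apply: (class_C_derivable (i := i) Cphi); exact: U0.
have dpsi s : 0 <= s <= e -> is_derive (s *: vi + u) vi psi
    (partial i phi (s *: vi + u + e *: vj) - partial i phi (s *: vi + u)).
  move=> sI; apply: is_deriveB; first exact: shift_phi.
  by apply: DeriveDef => //; exact: dphi.
have [s sI Es] := MVT_line e0 (fun s sI => @ex_derive _ _ _ _ _ _ _ (dpsi s sI)).
rewrite (@derive_val _ _ _ _ _ _ _ (dpsi s sI)) in Es.
have [|t tI Et] := @MVT_line (partial i phi) vj (s *: vi + u) e e0.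
  move=> t tI; apply: (class_C_derivable (i := j) (class_C_partial i Cphi)).
  by rewrite addrCA; exact: sqU.
exists s, t; split=> //.
have -> : s *: vi + (t *: vj + u) = t *: vj + (s *: vi + u) by rewrite addrCA.
rewrite -Et [e *: vj + (s *: vi + u)]addrC -Es /psi.
have -> : e *: vi + (e *: vj + u) = e *: vi + u + e *: vj by rewrite -addrA [u + _]addrC.
by rewrite [e *: vj + u]addrC; ring.
Qed.

(** Were the mixed derivatives different at [u], a square so small that each of
    them varies by less than half of their difference would contradict
    [second_difference], used in both orders. *)
Lemma partialC phi U u i j : open U -> class_C 2 U phi -> U u ->
  partial i (partial j phi) u = partial j (partial i phi) u.
Proof.
move=> oU Cphi Uu; apply/eqP/negPn/negP => neq.
pose a := partial i (partial j phi) u; pose b := partial j (partial i phi) u.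
pose eps := `|a - b| / 2.
have eps0 : 0 < eps by rewrite divr_gt0 // normr_gt0 subr_eq0.
have ca : {for u, continuous (partial i (partial j phi))}.
  exact: class_C_continuous oU (class_C_partial i (class_C_partial j Cphi)) Uu.
have cb : {for u, continuous (partial j (partial i phi))}.
  exact: class_C_continuous oU (class_C_partial j (class_C_partial i Cphi)) Uu.
have nU : \forall v \near u, U v by exact: open_nbhs_nbhs.
have na : \forall v \near u, `|a - partial i (partial j phi) v| < eps.
  exact: (cvgrPdist_lt (F := nbhs u) _ _).1 ca eps eps0.
have nb : \forall v \near u, `|b - partial j (partial i phi) v| < eps.
  exact: (cvgrPdist_lt (F := nbhs u) _ _).1 cb eps eps0.
have [d /= d0 dP] := (nbhs_ballP _ _).1 (filterI nU (filterI na nb)).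
pose vi : 'rV[R]_m := delta_mx 0 i; pose vj : 'rV[R]_m := delta_mx 0 j.
pose e := d / (`|vi| + `|vj| + 1).
have n0 : 0 < `|vi| + `|vj| + 1 by rewrite ltr_wpDl // addr_ge0.
have e0 : 0 < e by rewrite divr_gt0.
have near_sq s t : 0 <= s <= e -> 0 <= t <= e ->
    ball u d (s *: vi + (t *: vj + u)).
  move=> /andP[s0 se] /andP[t0 te]; rewrite -ball_normE /=.
  have -> : u - (s *: vi + (t *: vj + u)) = - (s *: vi + t *: vj).
    by rewrite addrA [_ + u]addrC opprD addrA subrr sub0r.
  rewrite normrN; apply: le_lt_trans (ler_normD _ _) _.
  rewrite !normrZ !ger0_norm //.
  have <- : e * (`|vi| + `|vj| + 1) = d by rewrite divfK // gt_eqF.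
  rewrite !mulrDr mulr1 -addrA ler_ltD ?ler_wpM2r //.
  by rewrite -[ltLHS]addr0 ler_ltD ?ler_wpM2r.
have [s [t [sI tI E1]]] := second_difference oU Cphi (ltW e0)
  (fun s t sI tI => let: conj Uv _ := dP _ (near_sq s t sI tI) in Uv).
have near_sq' t' s' : 0 <= t' <= e -> 0 <= s' <= e ->
    ball u d (t' *: vj + (s' *: vi + u)).
  by move=> tI' sI'; rewrite addrCA; exact: near_sq.
have [t' [s' [tI' sI' E2]]] := second_difference oU Cphi (ltW e0)
  (fun s t sI tI => let: conj Uv _ := dP _ (near_sq' s t sI tI) in Uv).
have [_ [_ lt_b]] := dP _ (near_sq s t sI tI).
have [_ [lt_a _]] := dP _ (near_sq' t' s' tI' sI').
have E : partial i (partial j phi) (t' *: vj + (s' *: vi + u)) =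
    partial j (partial i phi) (s *: vi + (t *: vj + u)).
  have e_neq0 : e != 0 by rewrite gt_eqF.
  apply: (mulfI e_neq0); apply: (mulfI e_neq0).
  apply: etrans (esym E2) (etrans _ E1).
  have -> : e *: vj + (e *: vi + u) = e *: vi + (e *: vj + u) by rewrite addrCA.
  rewrite -!addrA; congr (_ + _); rewrite !addrA; congr (_ + _).
  by rewrite addrC.
have : `|a - b| < eps + eps.
  rewrite E in lt_a; rewrite distrC in lt_b.
  by apply: le_lt_trans (ler_distD _ _ _) (ltrD lt_a lt_b).
by rewrite -splitr ltxx.
Qed.

Lemma partial_mxC p q (F : 'rV[R]_m -> 'M[R]_(p, q)) U u i j :
  open U -> class_C 2 U F -> U u ->
  partial i (partial j F) u = partial j (partial i F) u.
Proof.
move=> oU CF Uu; apply/matrixP => k l.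
have /(class_C_mxP _ _ oU) CFkl := CF.
have step i0 j0 : partial i0 (partial j0 F) u k l =
    partial i0 (partial j0 (fun v => F v k l)) u.
  rewrite partial_mx; last exact: class_C_derivable (class_C_partial j0 CF) Uu.
  apply: (partial_ext _ oU) => // v; rewrite inE => Uv.
  by rewrite partial_mx //; exact: class_C_derivable CF Uv.
have C := partialC i j oU (CFkl k l) Uu.
exact: etrans (step i j) (etrans C (esym (step j i))).
Qed.

End Schwarz.

(** * Kernels of linear families of matrices at maximal rank *)

Section Perturbation.
Context {R : numFieldType}.

Lemma exists_nonroot (p : {poly R}) : p != 0 -> exists2 s, s != 0 & p.[s] != 0.
Proof.
move=> p0; pose rs := [seq i%:R : R | i <- iota 0 (size ('X * p))].
have Xp0 : 'X * p != 0 by rewrite mulf_neq0 // polyX_eq0.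
have rs_uniq : uniq rs.
  by rewrite map_inj_uniq ?iota_uniq // => i j /eqP; rewrite eqr_nat => /eqP.
have : ~~ all (root ('X * p)) rs.
  apply/negP => /(max_poly_roots Xp0) /(_ rs_uniq).
  by rewrite size_map size_iota ltnn.
move=> /allPn[s _]; rewrite rootM negb_or /root hornerX => /andP[s0 ps].
by exists s.
Qed.

(** Up to a power of [t], the determinant is the characteristic polynomial of
    [- E] at [t^-1], which has a non-root other than [0]. *)
Lemma unitmx_add_scaled n (E : 'M[R]_n) :
  exists2 t, t != 0 & 1%:M + t *: E \in unitmx.
Proof.
have /exists_nonroot[s s0 ps] : char_poly (- E) != 0.
  exact/monic_neq0/char_poly_monic.
exists s^-1; first by rewrite invr_eq0.
have -> : 1%:M + s^-1 *: E = s^-1 *: (s%:M + E).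
  by rewrite scalerDr scale_scalar_mx mulVf.
rewrite unitmxE detZ unitfE mulf_neq0 ?expf_neq0 ?invr_eq0 //.
have <- : (char_poly (- E)).[s] = \det (s%:M + E); last by [].
rewrite -[LHS]/(horner_eval s _) -det_map_mx; congr (\det _).
apply/matrixP => i j; rewrite !mxE /= /horner_eval !hornerE.
by rewrite hornerMn hornerX opprK.
Qed.

(** A first-order perturbation argument.  The vector [w *m C] is a multiple of
    [w *m (B + t *: C)], hence in the row space of [B + t *: C]; if it were
    outside that of [B], it would raise the rank of [B + t *: C] above the rank of
    [B] for some [t != 0], by adding to perturbed versions of a basis of [B]. *)
Lemma mxrank_perturb m q (B C : 'M[R]_(m, q)) (w : 'rV[R]_m) :
  (forall t, (\rank (B + t *: C)%R <= \rank B)%N) ->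
  w *m B = 0 -> (w *m C <= B)%MS.
Proof.
move=> rkB wB; apply/negPn/negP => wCB.
pose r := \rank B; pose M := col_mx (row_base B) (w *m C).
have /row_freeP[P MP] : row_free M.
  have rkM : \rank M = \rank (B + w *m C)%MS.
    have E : (row_base B + w *m C :=: B + w *m C)%MS.
      by apply: adds_eqmx; [exact: eq_row_base | exact: eqmx_refl].
    by rewrite -addsmxE E.
  rewrite /row_free eqn_leq rank_leq_row; rewrite rkM [X in (X <= _)%N]addn1 /=.
  apply: rank_ltmx; rewrite /ltmx addsmxSl /=.
  by rewrite addsmx_sub negb_and wCB orbT.
pose S := row_base B *m pinvmx B.
have SB : S *m B = row_base B by rewrite mulmxKpV // eq_row_base.
have [t t0] := unitmx_add_scaled (col_mx (S *m C) 0 *m P).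
rewrite -MP scalemxAl -mulmxDl.
have -> : M + t *: col_mx (S *m C) 0
    = col_mx S (t^-1 *: w) *m (B + t *: C).
  rewrite scale_col_mx scaler0 add_col_mx addr0 mul_col_mx !mulmxDr SB.
  rewrite -!scalemxAl wB scaler0 add0r -!scalemxAr scalerA mulVf // scale1r.
  by rewrite -/r.
move/mxrank_unit => rk.
have : (\rank B + 1 <= \rank (B + t *: C)%R)%N.
  rewrite -[X in (X <= _)%N]rk.
  apply: (leq_trans (mxrankM_maxl _ _)); exact: mxrankS (submxMl _ _).
by rewrite addn1 ltnNge rkB.
Qed.

(** For a bilinear map [(Z, Y) |-> Y *m B Z], choose [Z] so that [B Z] has maximal
    rank; [mxrank_perturb] applies in every direction [V]. *)
Lemma max_rank_kernel m q (B : 'rV[R]_m -> 'M[R]_(m, q)) :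
  (forall Z V t, B (Z + t *: V) = B Z + t *: B V) ->
  (forall Z, (\rank (B Z) < m)%N) ->
  exists Z, (exists2 W : 'rV_m, W != 0 & W *m B Z = 0) /\
    forall (W V : 'rV_m), W *m B Z = 0 -> (W *m B V <= B Z)%MS.
Proof.
move=> linB rkB.
pose P r := `[< exists Z, \rank (B Z) = r >].
have exP : exists r, P r by exists (\rank (B 0)); apply/asboolP; exists 0.
have leP r : P r -> (r <= m)%N by move=> /asboolP[Z <-]; exact: ltnW.
have [r /asboolP[Z rkZ] maxr] := ex_maxnP exP leP.
exists Z; split.
  have : kermx (B Z) != 0 by rewrite kermx_eq0 /row_free neq_ltn rkB.
  move=> /rowV0Pn[W /sub_kermxP WB W0]; by exists W.
move=> W V WB; apply: mxrank_perturb WB => t.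
by rewrite -linB rkZ; apply: maxr; apply/asboolP; exists (Z + t *: V).
Qed.

End Perturbation.

(** * Flat bilinear forms *)

Section InnerProduct.
Context {R : comNzRingType} {s : nat} (eta : 'M[R]_s).
Implicit Types x y z : 'rV[R]_s.

Definition dot x y : R := (x *m eta *m y^T) 0 0.

Lemma dotDl x y z : dot (x + y) z = dot x z + dot y z.
Proof. by rewrite /dot !mulmxDl mxE. Qed.

Lemma dotDr x y z : dot x (y + z) = dot x y + dot x z.
Proof. by rewrite /dot linearD mulmxDr mxE. Qed.

Lemma dotZl a x y : dot (a *: x) y = a * dot x y.
Proof. by rewrite /dot -!scalemxAl mxE. Qed.

Lemma dotZr a x y : dot x (a *: y) = a * dot x y.
Proof. by rewrite /dot linearZ -scalemxAr mxE. Qed.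

Lemma dotNl x y : dot (- x) y = - dot x y.
Proof. by rewrite /dot !mulNmx mxE. Qed.

Lemma dotNr x y : dot x (- y) = - dot x y.
Proof. by rewrite /dot linearN mulmxN mxE. Qed.

Lemma dotC x y : eta^T = eta -> dot x y = dot y x.
Proof.
move=> etaC; rewrite /dot.
have -> : x *m eta *m y^T = (y *m eta *m x^T)^T.
  by rewrite !trmx_mul trmxK etaC mulmxA.
by rewrite mxE.
Qed.

Lemma dot_row p q (A : 'M[R]_(p, s)) (B : 'M[R]_(q, s)) i j :
  (A *m eta *m B^T) i j = dot (row i A) (row j B).
Proof.
by rewrite /dot -row_mul !mxE; apply: eq_bigr => k _; rewrite !mxE.
Qed.

End InnerProduct.

Section FlatForm.
Context {R : numFieldType} {m s : nat}.
Variables (eta : 'M[R]_s) (A : 'rV[R]_m -> 'M[R]_(m, s)) (J : 'M[R]_m).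
Hypothesis eta_sym : eta^T = eta.
Hypothesis J2 : J *m J = - 1%:M.
Hypothesis A_linear : forall Z V t, A (Z + t *: V) = A Z + t *: A V.
Hypothesis A_sym : forall X Y, Y *m A X = X *m A Y.
Let gram_diff X Y := A X *m eta *m (A Y)^T - A Y *m eta *m (A X)^T.
Hypothesis A_flat : forall X Y, gram_diff X Y = J *m gram_diff X Y *m J^T.
Local Notation "<< x , y >>" := (dot eta x y).

(** With the split form that is [eta] on the first and [- eta] on the second
    summand, [gamma X Y = (Y *m A X, Y *m J *m A X)] is a flat bilinear form:
    [A_flat] says that the product of [gamma X Y] and [gamma Z W] is unchanged
    when [Y] and [W] are exchanged.  Hence the image of [gamma Z] is orthogonal to
    [gamma V Y] whenever [gamma Z Y = 0]. *)
Lemma kernel_orthogonal Z C V Y : Y *m A Z = 0 -> Y *m J *m A Z = 0 ->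
  << C *m A Z, Y *m A V >> = << C *m J *m A Z, Y *m J *m A V >>.
Proof.
move=> YZ YJZ.
have expand B D : (B *m gram_diff Z V *m D^T) 0 0 =
    << B *m A Z, D *m A V >> - << B *m A V, D *m A Z >>.
  by rewrite /dot !trmx_mul /gram_diff mulmxBr mulmxBl !mulmxA [LHS]mxE
    [X in _ + X]mxE.
have := expand C Y; rewrite A_flat YZ.
have -> : C *m (J *m gram_diff Z V *m J^T) *m Y^T = C *m J *m gram_diff Z V *m (Y *m J)^T.
  by rewrite trmx_mul !mulmxA.
rewrite expand YJZ.
have z x : << x, 0 >> = 0 by rewrite /dot trmx0 mulmx0 mxE.
by rewrite !z !subr0.
Qed.

(** Take [Z] such that [gamma Z] has maximal rank, and [W] in its kernel, which is
    nonzero by the rank bound.  All the values [gamma V W] and [gamma V (W *m J)]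
    then belong to the image of [gamma Z] and are orthogonal to it by
    [kernel_orthogonal], so that they are pairwise orthogonal and null.  Spelled
    out for [V = W] and [V = W *m J], these relations give
    [<<a, a>> = <<b, b>> = <<d, d>> = - <<a, d>>] for the three components [a],
    [b], [d], and the square of [a + d] vanishes. *)
Lemma exists_null_value : (forall Z, (\rank (A Z)).*2 < m)%N ->
  exists2 W, W != 0 & let b := W *m A W + W *m J *m A (W *m J) in << b, b >> = 0.
Proof.
move=> rkA; pose B Z := row_mx (A Z) (J *m A Z).
have linB Z V t : B (Z + t *: V) = B Z + t *: B V.
  by rewrite /B A_linear mulmxDr -scalemxAr scale_row_mx add_row_mx.
have rkB Z : (\rank (B Z) < m)%N.
  apply: leq_ltn_trans (rkA Z); rewrite -addnn -mxrank_tr tr_row_mx.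
  rewrite -(addsmxE _ _).1; apply: leq_trans (mxrank_adds_leqif _ _) _.
  by rewrite !mxrank_tr leq_add2l; exact: mxrankM_maxr.
have [Z [[W W0 WB] imB]] := max_rank_kernel linB rkB.
have /eq_row_mx[WZ] : row_mx (W *m A Z) (W *m (J *m A Z)) = row_mx 0 0.
  by rewrite -mul_mx_row WB row_mx0.
rewrite mulmxA => WJZ.
have WJJ : W *m J *m J = - W by rewrite -mulmxA J2 mulmxN mulmx1.
have WJJZ : W *m J *m J *m A Z = 0 by rewrite WJJ mulNmx WZ oppr0.
have [C CB] := submxP (imB W W WB); have [C' CB'] := submxP (imB W (W *m J) WB).
have /eq_row_mx[CW CJW] : row_mx (W *m A W) (W *m (J *m A W)) =
    row_mx (C *m A Z) (C *m (J *m A Z)) by rewrite -!mul_mx_row.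
have /eq_row_mx[CW' CJW'] :
    row_mx (W *m A (W *m J)) (W *m (J *m A (W *m J))) =
    row_mx (C' *m A Z) (C' *m (J *m A Z)) by rewrite -!mul_mx_row.
rewrite !mulmxA in CJW CJW'.
exists W => //=.
set a := W *m A W; set d := W *m J *m A (W *m J); set b := W *m A (W *m J).
have bE : W *m J *m A W = b by rewrite A_sym.
have aa : << a, a >> = << b, b >>.
  by have := kernel_orthogonal C W WZ WJZ; rewrite -CW -CJW bE.
have dd : << b, b >> = << d, d >>.
  by have := kernel_orthogonal C' (W *m J) WZ WJZ; rewrite -CW' -CJW'.
have ad : << a, d >> = - << b, b >>.
  have := kernel_orthogonal C (W *m J) WJZ WJJZ.
  by rewrite -CW -CJW bE WJJ mulNmx dotNr.
rewrite dotDl !dotDr (dotC d a eta_sym) ad -dd aa; ring.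
Qed.

End FlatForm.

(** * Causality in the Lorentz space *)

Section Minkowski.
Context {R : realType} {N : nat}.
Implicit Types x y b o : 'rV[R]_N.+1.

Definition lorentz_mx : 'M[R]_N.+1 := diag_mx (\row_j (if j == 0 then -1 else 1)).

Lemma lorentz_mx_sym : lorentz_mx^T = lorentz_mx.
Proof. exact: tr_diag_mx. Qed.

Lemma lorentzE x y : lorentz x y = dot lorentz_mx x y.
Proof.
rewrite /lorentz /dot /lorentz_mx mul_mx_diag mxE big_ord_recl !mxE eqxx.
rewrite addrC; congr (_ + _); first by rewrite mulrN1 mulNr.
by apply: eq_bigr => i _; rewrite !mxE mulr1.
Qed.

Lemma lorentzC x y : lorentz x y = lorentz y x.
Proof. by rewrite !lorentzE (dotC _ _ lorentz_mx_sym). Qed.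

(** The reversed Cauchy-Schwarz inequality, from the nonnegativity of the sum of
    the squares of [y_0 x_i - x_0 y_i]. *)
Lemma lorentz_causal_le0 x y : lorentz x x <= 0 -> lorentz y y <= 0 ->
  0 < x 0 0 -> 0 < y 0 0 -> lorentz x y <= 0.
Proof.
rewrite /lorentz => xx yy x0 y0.
set s := \sum_i _; set sx := \sum_i _ in xx; set sy := \sum_i _ in yy.
have : 0 <= \sum_(i < N) (y 0 0 * x 0 (lift ord0 i) - x 0 0 * y 0 (lift ord0 i)) ^+ 2.
  by apply: sumr_ge0 => i _; exact: sqr_ge0.
have -> : \sum_(i < N) (y 0 0 * x 0 (lift ord0 i) - x 0 0 * y 0 (lift ord0 i)) ^+ 2
    = y 0 0 ^+ 2 * sx + x 0 0 ^+ 2 * sy - 2 * (x 0 0 * y 0 0) * s.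
  rewrite /s /sx /sy !mulr_sumr -sumrN -!big_split /=.
  by apply: eq_bigr => i _; ring.
move=> H; rewrite subr_le0 -(ler_pM2l (mulr_gt0 x0 y0)).
have H1 : y 0 0 ^+ 2 * sx <= y 0 0 ^+ 2 * (x 0 0 * x 0 0).
  by rewrite ler_wpM2l ?sqr_ge0 // -subr_le0.
have H2 : x 0 0 ^+ 2 * sy <= x 0 0 ^+ 2 * (y 0 0 * y 0 0).
  by rewrite ler_wpM2l ?sqr_ge0 // -subr_le0.
set P := x 0 0 * y 0 0 in H *.
have E1 : y 0 0 ^+ 2 * (x 0 0 * x 0 0) = P * P by rewrite /P; ring.
have E2 : x 0 0 ^+ 2 * (y 0 0 * y 0 0) = P * P by rewrite /P; ring.
rewrite E1 in H1; rewrite E2 in H2; move: H; rewrite -mulrA; lra.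
Qed.

Lemma lorentz_future x y : lorentz x x <= 0 -> lorentz y y <= 0 ->
  0 < y 0 0 -> lorentz x y < 0 -> 0 < x 0 0.
Proof.
move=> xx yy y0 xy; case: (ltrgtP (x 0 0) 0) => // [x_lt0|x0].
  have := @lorentz_causal_le0 (- x) y _ yy _ y0.
  rewrite !lorentzE !dotNl dotNr opprK -!lorentzE mxE oppr_gt0 oppr_le0.
  by move=> /(_ xx x_lt0); rewrite leNgt xy.
have xi i : x 0 (lift ord0 i) = 0.
  have sum0 : \sum_(j < N) x 0 (lift ord0 j) * x 0 (lift ord0 j) = 0.
    apply/eqP; rewrite eq_le sumr_ge0; last by move=> j _; rewrite -expr2 sqr_ge0.
    by move: xx; rewrite /lorentz x0 mul0r subr0 => ->.
  have := psumr_eq0P (fun j _ => sqr_ge0 (x 0 (lift ord0 j))) sum0.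
  by move=> /(_ i isT) /eqP; rewrite mulf_eq0 orbb => /eqP.
move: xy; rewrite /lorentz x0 mul0r subr0 big1 ?ltxx // => i _.
by rewrite xi mul0r.
Qed.

(** Two observers [x] and [o] at bounded distance measure comparable energies of a
    light ray [b]: the vector [o - t x] is still timelike and future-directed for
    [t = 1 / (2 C)], so its product with [b] is nonpositive. *)
Lemma null_observer_bound x o b (C : R) :
  lorentz x x = -1 -> 0 < x 0 0 -> lorentz o o = -1 -> 0 < o 0 0 ->
  0 < C -> - lorentz o x <= C ->
  lorentz b b = 0 -> lorentz b x < 0 -> - lorentz b x <= 2 * C * - lorentz b o.
Proof.
move=> xx x0 oo o0 C0 oxC bb bx.
pose t := (2 * C)^-1; pose q := o - t *: x.
have t0 : 0 < t by rewrite invr_gt0 mulr_gt0.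
have tC : t * (2 * C) = 1 by rewrite mulVf // gt_eqF // mulr_gt0.
have tox : t * - lorentz o x <= 2^-1.
  have := ler_wpM2l (ltW t0) oxC; move: tC; lra.
have qo : lorentz q o = -1 - t * lorentz o x.
  rewrite lorentzE dotDl dotNl dotZl -!lorentzE oo (lorentzC x o); ring.
have qq : lorentz q q = -1 - 2 * (t * lorentz o x) - t * t.
  rewrite lorentzE dotDr dotNr dotZr -lorentzE qo.
  rewrite dotDl dotNl dotZl -!lorentzE xx; ring.
have tt : 0 < t * t by rewrite mulr_gt0.
have qq0 : lorentz q q <= 0 by rewrite qq; lra.
have q0 : 0 < q 0 0.
  by apply: (lorentz_future qq0 _ o0); rewrite ?oo ?qo; lra.
have b0 : 0 < b 0 0 by apply: (lorentz_future _ _ x0 bx); rewrite ?bb ?xx //; lra.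
have bq : lorentz b q <= 0 by apply: lorentz_causal_le0; rewrite ?bb.
rewrite lorentzE dotDr dotNr dotZr -!lorentzE in bq.
have : 2 * C * (lorentz b o - t * lorentz b x) <= 0.
  by rewrite mulr_ge0_le0 // mulr_ge0 // ltW.
by rewrite mulrBr mulrA [2 * C * t]mulrC tC mul1r; lra.
Qed.

End Minkowski.

(** * The Gauss equation *)

Lemma subr_cancel_common (V : zmodType) (c x y x' y' : V) :
  (x - x' - (y - y') = c + x - (c + y) - (x' - y'))%R.
Proof.
have -> : (c + x - (c + y) = x - y)%R by rewrite opprD addrACA subrr add0r.
by rewrite !opprB addrACA [in RHS]addrACA [(- y - _)%R]addrC.
Qed.

Section Gauss.
Context {R : realType} {m s : nat} (eta : 'M[R]_s) (U : set 'rV[R]_m).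
Hypotheses (U_open : open U) (eta_sym : eta^T = eta).
Implicit Types (X : 'rV[R]_m -> 'M[R]_(m, s)) (g : 'rV[R]_m -> 'M[R]_m).

(** The curvature is never named.  Since [partial k X eta X^T = Gam k g], taking
    the derivative in the direction [l] and antisymmetrizing in [k] and [l] cancels
    the third-order terms and leaves products of derivatives of [X], which split
    into a part tangent to [X] and the part [B].  The right-hand side depends on
    [Gam] and [g] alone: two frames [X] with the same metric and connection
    coefficients have the same left-hand side. *)
Lemma gauss_equation X g (Gam : 'I_m -> 'rV[R]_m -> 'M[R]_m) k l u :
    class_C 2 U X -> (forall v, U v -> g v = X v *m eta *m (X v)^T) ->
    (forall i v, U v -> partial i X v *m eta *m (X v)^T = Gam i v *m g v) -> U u ->
  let B i := partial i X u - Gam i u *m X u in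
  B k *m eta *m (B l)^T - B l *m eta *m (B k)^T =
    partial l (fun v => Gam k v *m g v) u - partial k (fun v => Gam l v *m g v) u
    - (Gam k u *m g u *m (Gam l u)^T - Gam l u *m g u *m (Gam k u)^T).
Proof.
move=> CX gE dX Uu B.
have CX1 : class_C 1 U X by exact: class_CW.
have Ceta : class_C 1 U (fun=> eta) by exact: class_C_cst.
have g_sym : (g u)^T = g u by rewrite gE // !trmx_mul trmxK eta_sym mulmxA.
have dGam i j : partial j (fun v => Gam i v *m g v) u =
    partial j (partial i X) u *m eta *m (X u)^T
    + partial i X u *m eta *m (partial j X u)^T.
  have CdX : class_C 1 U (partial i X) by exact: class_C_partial.
  have CdXeta : class_C 1 U (fun v => partial i X v *m eta) by exact: class_C_mulmx.
  rewrite -(@partial_ext _ _ _ U (fun v => partial i X v *m eta *m (X v)^T)) //; last first.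
    by move=> v; rewrite inE => Uv; exact: dX.
  rewrite (partial_mulmx _ U_open CdXeta (class_C_trmx U_open CX1) Uu).
  rewrite (partial_trmx _ U_open CX1 Uu) (partial_mulmx _ U_open CdX Ceta Uu).
  have -> : partial j (fun=> eta) u = 0 by exact: derive_cst.
  by rewrite mulmx0 addr0.
have dX' i : X u *m eta *m (partial i X u)^T = g u *m (Gam i u)^T.
  rewrite -{1}[X u]trmxK -{1}eta_sym -mulmxA -!trmx_mul dX // trmx_mul.
  by rewrite g_sym.
have BB i j : B i *m eta *m (B j)^T =
    partial i X u *m eta *m (partial j X u)^T - Gam i u *m g u *m (Gam j u)^T.
  have T1 : partial i X u *m eta *m ((X u)^T *m (Gam j u)^T)
      = Gam i u *m g u *m (Gam j u)^T.
    by rewrite mulmxA dX.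
  have T2 : Gam i u *m X u *m eta *m (partial j X u)^T = Gam i u *m g u *m (Gam j u)^T.
    by rewrite -!mulmxA (mulmxA (X u)) dX'.
  have T3 : Gam i u *m X u *m eta *m ((X u)^T *m (Gam j u)^T)
      = Gam i u *m g u *m (Gam j u)^T.
    by rewrite gE // !mulmxA.
  rewrite /B linearB /= trmx_mul mulmxBr mulmxBl [in X in _ - X]mulmxBl mulmxBl T1.
  by rewrite T2 T3 subrr subr0.
rewrite !BB !dGam (partial_mxC k l U_open CX Uu).
exact: subr_cancel_common.
Qed.

End Gauss.

(** * Immersions into the hyperboloid *)

Section Immersion.
Context {R : realType} {m N : nat} (U : set 'rV[R]_m).
Variables (F : 'rV[R]_m -> 'rV[R]_N.+1) (g : 'rV[R]_m -> 'M[R]_m).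
Hypotheses (U_open : open U) (F_class : class_C 3 U F).
Hypothesis F_isometric : forall u i j, U u ->
  lorentz (partial i F u) (partial j F u) = g u i j.
Hypothesis g_unit : forall u, U u -> g u \in unitmx.
Local Notation eta := (@lorentz_mx R N).

Definition frame u : 'M[R]_(m, N.+1) := \matrix_(i < m) partial i F u.

Definition christoffel_mx k u : 'M[R]_m := \matrix_(i, j)
  (2^-1 * \sum_(l < m) invmx (g u) j l *
    (partial k g u i l + partial i g u k l - partial l g u k i)).

(** Row [i] is the second fundamental form at [(d_k, d_i)] of the immersion into
    the flat Lorentz space, not into the hyperboloid: it includes the component
    along the position vector. *)
Definition second_form u k : 'M[R]_(m, N.+1) :=
  partial k frame u - christoffel_mx k u *m frame u.

Lemma row_frame i u : row i (frame u) = partial i F u.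
Proof. exact: rowK. Qed.

Lemma frame_class : class_C 2 U frame.
Proof.
apply/class_C_mxP => // i j.
have /(class_C_mxP _ _ U_open) CiF := class_C_partial i F_class.
by apply: class_C_ext (CiF 0 j) => // u _; rewrite mxE.
Qed.

Lemma gram_frame u : U u -> g u = frame u *m eta *m (frame u)^T.
Proof.
move=> Uu; apply/matrixP => i j; rewrite -F_isometric // lorentzE.
by rewrite dot_row !row_frame.
Qed.

Lemma gram_sym_frame u : U u -> (g u)^T = g u.
Proof.
by move=> Uu; rewrite gram_frame // !trmx_mul trmxK lorentz_mx_sym mulmxA.
Qed.

Lemma row_partial_frame k i u : U u ->
  row i (partial k frame u) = partial k (partial i F) u.
Proof.
move=> Uu; apply/rowP => j.
have -> : row i (partial k frame u) 0 j = partial k frame u i j by rewrite mxE.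
rewrite partial_mx; last exact: class_C_derivable frame_class Uu.
rewrite partial_mx; last exact: class_C_derivable (class_C_partial i F_class) Uu.
by apply: (partial_ext _ U_open) => // v _; rewrite mxE.
Qed.

Lemma partial_frameC k i u : U u ->
  row i (partial k frame u) = row k (partial i frame u).
Proof.
move=> Uu; rewrite (row_partial_frame k i Uu) (row_partial_frame i k Uu).
exact: (partial_mxC k i U_open (class_CW F_class) Uu).
Qed.

Lemma partial_gram k u : U u -> partial k g u =
  partial k frame u *m eta *m (frame u)^T + frame u *m eta *m (partial k frame u)^T.
Proof.
move=> Uu.
have CP : class_C 1 U frame by exact: class_CW frame_class.
have Ceta : class_C 1 U (fun=> eta) by exact: class_C_cst.
rewrite (@partial_ext _ _ _ U _ (fun v => frame v *m eta *m (frame v)^T)) //; last first.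
  by move=> v; rewrite inE => Uv; exact: gram_frame.
rewrite (partial_mulmx _ U_open (class_C_mulmx U_open CP Ceta) (class_C_trmx U_open CP) Uu).
rewrite (partial_trmx _ U_open CP Uu) (partial_mulmx _ U_open CP Ceta Uu).
have -> : partial k (fun=> eta) u = 0 by exact: derive_cst.
by rewrite mulmx0 addr0.
Qed.

(** The Koszul formula: with [gam k i j] the product of [d_k d_i F] and [d_j F],
    which is symmetric in [k] and [i], the combination of derivatives of the metric
    in the Christoffel symbols is [2 gam k i j]. *)
Lemma christoffel_frame k u : U u ->
  partial k frame u *m eta *m (frame u)^T = christoffel_mx k u *m g u.
Proof.
move=> Uu; pose gam k i j := dot eta (row i (partial k frame u)) (row j (frame u)).
have gamC a b c : gam a b c = gam b a c by rewrite /gam partial_frameC.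
have dg a b c : partial a g u b c = gam a b c + gam a c b.
  rewrite (partial_gram a Uu) [LHS]mxE !dot_row /gam; congr (_ + _).
  exact: dotC lorentz_mx_sym.
pose H := \matrix_(i, l)
  (2^-1 * (partial k g u i l + partial i g u k l - partial l g u k i)).
have -> : christoffel_mx k u = H *m (invmx (g u))^T.
  apply/matrixP => i j; rewrite !mxE mulr_sumr; apply: eq_bigr => l _.
  by rewrite !mxE [invmx _ _ _ * _]mulrC mulrA.
rewrite trmx_inv gram_sym_frame // mulmxKV ?g_unit //.
apply/matrixP => i j; rewrite dot_row mxE !dg -/(gam k i j).
rewrite (gamC i k j) (gamC j k i) (gamC i j k) (gamC k j i) (gamC k i j).
by field.
Qed.

Lemma second_form_normal k u : U u -> second_form u k *m eta *m (frame u)^T = 0.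
Proof.
move=> Uu; rewrite /second_form !mulmxBl christoffel_frame // -!mulmxA.
by rewrite (mulmxA (frame u)) -gram_frame // subrr.
Qed.

Lemma second_formC k i u : U u -> row i (second_form u k) = row k (second_form u i).
Proof.
move=> Uu; rewrite /second_form !linearB /= partial_frameC // !row_mul.
congr (_ - _ *m _); apply/rowP => j; rewrite !mxE; congr (_ * _).
apply: eq_bigr => l _; congr (_ * _).
have -> : partial l g u k i = partial l g u i k.
  rewrite (partial_gram l Uu) [LHS]mxE [RHS]mxE !dot_row addrC; congr (_ + _);
    exact: dotC lorentz_mx_sym.
by rewrite [X in X - _]addrC.
Qed.

Section HyperboloidValued.
Hypothesis F_norm : forall u, U u -> lorentz (F u) (F u) = -1.

Lemma frame_position u : U u -> frame u *m eta *m (F u)^T = 0.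
Proof.
move=> Uu; apply/matrixP => k j; rewrite [RHS]mxE dot_row row_frame.
have -> : row j (F u) = F u by apply/rowP => l; rewrite !mxE !ord1.
have CF : class_C 1 U F by exact: class_C_le F_class.
have Ceta : class_C 1 U (fun=> eta) by exact: class_C_cst.
have : partial k (fun v => F v *m eta *m (F v)^T) u = 0.
  rewrite (@partial_ext _ _ _ U _ (fun=> (-1)%:M)) //; first exact: derive_cst.
  move=> v; rewrite inE => Uv; apply/matrixP => a b.
  by rewrite !ord1 -[LHS]/(dot eta (F v) (F v)) -lorentzE F_norm // !mxE.
rewrite (partial_mulmx _ U_open (class_C_mulmx U_open CF Ceta) (class_C_trmx U_open CF) Uu).
rewrite (partial_trmx _ U_open CF Uu) (partial_mulmx _ U_open CF Ceta Uu).
have -> : partial k (fun=> eta) u = 0 by exact: derive_cst.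
rewrite mulmx0 addr0 => /matrixP/(_ 0 0); rewrite mxE [RHS]mxE.
rewrite -/(dot eta _ _) -/(dot eta _ _) (dotC (F u) _ lorentz_mx_sym).
by move/eqP; rewrite -mulr2n mulrn_eq0 => /eqP.
Qed.

(** The derivative of the orthogonality of the frame to the position vector.  In
    particular the second fundamental form is definite in the direction of [F]. *)
Lemma second_form_position k u : U u ->
  second_form u k *m eta *m (F u)^T = - col k (g u).
Proof.
move=> Uu.
have CF : class_C 1 U F by exact: class_C_le F_class.
have CP : class_C 1 U frame by exact: class_CW frame_class.
have Ceta : class_C 1 U (fun=> eta) by exact: class_C_cst.
have : partial k (fun v => frame v *m eta *m (F v)^T) u = 0.
  rewrite (@partial_ext _ _ _ U _ (fun=> 0)) //; first exact: derive_cst.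
  by move=> v; rewrite inE => Uv; exact: frame_position.
rewrite (partial_mulmx _ U_open (class_C_mulmx U_open CP Ceta) (class_C_trmx U_open CF) Uu).
rewrite (partial_trmx _ U_open CF Uu) (partial_mulmx _ U_open CP Ceta Uu).
have -> : partial k (fun=> eta) u = 0 by exact: derive_cst.
rewrite mulmx0 addr0 => /eqP; rewrite addr_eq0 => /eqP E.
have Z : christoffel_mx k u *m frame u *m eta *m (F u)^T = 0.
  by rewrite -!mulmxA (mulmxA (frame u)) frame_position // mulmx0.
rewrite /second_form !mulmxBl Z E subr0 gram_frame //; congr (- _).
by rewrite colE -!mulmxA -colE -tr_row row_frame.
Qed.

End HyperboloidValued.

Definition second_form_along u (X : 'rV[R]_m) : 'M[R]_(m, N.+1) :=
  \sum_(k < m) X 0 k *: second_form u k.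

Lemma second_form_along_linear u X Y t : second_form_along u (X + t *: Y) =
  second_form_along u X + t *: second_form_along u Y.
Proof.
rewrite /second_form_along scaler_sumr -big_split /=.
by apply: eq_bigr => k _; rewrite !mxE scalerDl scalerA.
Qed.

Lemma second_form_along_sum u (X Y : 'rV[R]_m) : Y *m second_form_along u X =
  \sum_(k < m) \sum_(i < m) (X 0 k * Y 0 i) *: row i (second_form u k).
Proof.
rewrite /second_form_along mulmx_sumr; apply: eq_bigr => k _.
rewrite -scalemxAr mulmx_sum_row scaler_sumr.
by apply: eq_bigr => i _; rewrite scalerA.
Qed.

Lemma second_form_alongC u X Y : U u ->
  Y *m second_form_along u X = X *m second_form_along u Y.
Proof.
move=> Uu; rewrite !second_form_along_sum exchange_big /=.
by apply: eq_bigr => i _; apply: eq_bigr => k _; rewrite mulrC (second_formC _ _ Uu).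
Qed.

Lemma rank_second_form_along u X : U u ->
  (\rank (second_form_along u X) <= N.+1 - m)%N.
Proof.
move=> Uu.
have normal : second_form_along u X *m (eta *m (frame u)^T) = 0.
  rewrite mulmxA /second_form_along !mulmx_suml big1 // => k _.
  by rewrite -!scalemxAl second_form_normal // scaler0.
have full : (m <= \rank (eta *m (frame u)^T))%N.
  rewrite -{1}(mxrank_unit (g_unit Uu)) gram_frame // -mulmxA.
  exact: mxrankM_maxr.
have := mulmx0_rank_max normal; lia.
Qed.

Lemma second_form_along_position u X : (forall v, U v -> lorentz (F v) (F v) = -1) ->
  U u -> lorentz (X *m second_form_along u X) (F u) = - (X *m g u *m X^T) 0 0.
Proof.
move=> F_norm Uu; rewrite lorentzE /dot.
have -> : X *m second_form_along u X *m eta *m (F u)^T =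
    X *m (second_form_along u X *m eta *m (F u)^T) by rewrite !mulmxA.
have -> : second_form_along u X *m eta *m (F u)^T = - (g u *m X^T).
  rewrite /second_form_along !mulmx_suml.
  apply/matrixP => i j; rewrite summxE !mxE -sumrN; apply: eq_bigr => k _.
  rewrite -!scalemxAl second_form_position // !mxE !ord1 mulrN.
  by rewrite mulrC.
by rewrite mulmxN mulmxA mxE.
Qed.

Section Kaehler.
Variable J : 'rV[R]_m -> 'M[R]_m.
Hypotheses (J_class : class_C 2 U J) (J2 : forall u, U u -> J u *m J u = - 1%:M).
Hypothesis J_orthogonal : forall u, U u -> J u *m g u *m (J u)^T = g u.
Hypothesis J_parallel : forall k u, U u ->
  partial k J u = christoffel_mx k u *m J u - J u *m christoffel_mx k u.

(** The frame [Q = J frame] has the same metric as [frame], since [J] is orthogonal,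
    and the same connection coefficients, since [J] is parallel, and its normal part
    is [J second_form].  So [gauss_equation] for [frame] and for [Q] have the same
    right-hand side.  This replaces the commutation of the curvature with [J]. *)
Lemma second_form_flat k l u : U u ->
  let D := second_form u k *m eta *m (second_form u l)^T
           - second_form u l *m eta *m (second_form u k)^T in
  D = J u *m D *m (J u)^T.
Proof.
move=> Uu D.
have CJ : class_C 1 U J by exact: class_CW.
have CP : class_C 1 U frame by exact: class_CW frame_class.
pose Q v := J v *m frame v.
have CQ : class_C 2 U Q by exact: class_C_mulmx frame_class.
have dQ i v : U v -> partial i Q v = christoffel_mx i v *m Q v + J v *m second_form v i.
  move=> Uv; rewrite (partial_mulmx _ U_open CJ CP Uv) (J_parallel _ Uv).
  by rewrite mulmxBl -mulmxA /second_form mulmxBr -/(Q v) !mulmxA addrA addrAC.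
have Q_gram v : U v -> g v = Q v *m eta *m (Q v)^T.
  by move=> Uv; rewrite -[LHS]J_orthogonal // gram_frame // trmx_mul !mulmxA.
have dQQ i v : U v -> partial i Q v *m eta *m (Q v)^T = christoffel_mx i v *m g v.
  move=> Uv.
  have -> : christoffel_mx i v *m g v = christoffel_mx i v *m Q v *m eta *m (Q v)^T.
    by rewrite Q_gram // !mulmxA.
  have normal : J v *m second_form v i *m eta *m (Q v)^T = 0.
    have -> : J v *m second_form v i *m eta *m (Q v)^T =
        J v *m (second_form v i *m eta *m (frame v)^T) *m (J v)^T.
      by rewrite /Q trmx_mul !mulmxA.
    by rewrite second_form_normal // mulmx0 mul0mx.
  by rewrite dQ // !mulmxDl normal addr0.
have GP := gauss_equation U_open lorentz_mx_sym k l frame_class gram_frame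
  christoffel_frame Uu.
have GQ := gauss_equation U_open lorentz_mx_sym k l CQ Q_gram dQQ Uu.
have BQ i : partial i Q u - christoffel_mx i u *m Q u = J u *m second_form u i.
  by rewrite dQ // addrC addKr.
have -> : J u *m D *m (J u)^T =
    (J u *m second_form u k) *m eta *m (J u *m second_form u l)^T
    - (J u *m second_form u l) *m eta *m (J u *m second_form u k)^T.
  by rewrite /D !trmx_mul mulmxBr mulmxBl !mulmxA.
rewrite -(BQ k) -(BQ l); exact: etrans GP (esym GQ).
Qed.

(** The hypothesis on dimensions comes from the two components of the flat form,
    each with values in the normal space of dimension [N.+1 - m]. *)
Lemma exists_null_direction u : U u -> ((N.+1 - m).*2 < m)%N ->
  exists2 W : 'rV[R]_m, W != 0 &
    let b := W *m second_form_along u W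
             + W *m J u *m second_form_along u (W *m J u) in
    lorentz b b = 0.
Proof.
move=> Uu codim.
have flat X Y (S := second_form_along u) (D := fun X Y =>
    S X *m eta *m (S Y)^T - S Y *m eta *m (S X)^T) : D X Y = J u *m D X Y *m (J u)^T.
  have -> : D X Y = \sum_(k < m) \sum_(l < m) (X 0 k * Y 0 l) *:
      (second_form u k *m eta *m (second_form u l)^T
       - second_form u l *m eta *m (second_form u k)^T).
    have prod Z V : S Z *m eta *m (S V)^T = \sum_(k < m) \sum_(l < m)
        (Z 0 k * V 0 l) *: (second_form u k *m eta *m (second_form u l)^T).
      rewrite {1}/S {1}/second_form_along !mulmx_suml; apply: eq_bigr => k _.
      rewrite /S /second_form_along linear_sum mulmx_sumr; apply: eq_bigr => l _.
      by rewrite linearZ /= -!scalemxAl -scalemxAr scalerA.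
    rewrite /D !prod [X in _ - X]exchange_big -sumrB; apply: eq_bigr => k _.
    rewrite -sumrB; apply: eq_bigr => l _; rewrite scalerBr.
    by rewrite [Y 0 l * _]mulrC.
  rewrite mulmx_sumr mulmx_suml; apply: eq_bigr => k _.
  rewrite mulmx_sumr mulmx_suml; apply: eq_bigr => l _.
  by rewrite -scalemxAr -scalemxAl -second_form_flat.
have [|W W0 Wb] := exists_null_value lorentz_mx_sym (J2 Uu)
  (second_form_along_linear u) (fun X Y => second_form_alongC X Y Uu) flat.
  by move=> Z; apply: leq_ltn_trans codim; rewrite leq_double rank_second_form_along.
by exists W => //; rewrite /= lorentzE.
Qed.

End Kaehler.

Section Height.
Variable o : 'rV[R]_N.+1.
Let height u : R := - lorentz (F u) o.

Lemma partial_mulmx_cst q (G : 'rV[R]_m -> 'M[R]_(1, N.+1)) (c : 'M[R]_(N.+1, q)) k u :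
  class_C 1 U G -> U u -> partial k (fun v => G v *m c) u = partial k G u *m c.
Proof.
move=> CG Uu; rewrite (partial_mulmx _ U_open CG (class_C_cst _ _ U_open) Uu).
have -> : partial k (fun=> c) u = 0 by exact: derive_cst.
by rewrite mulmx0 addr0.
Qed.

Lemma class_C_lorentz d (G : 'rV[R]_m -> 'rV[R]_N.+1) :
  class_C d U G -> class_C d U (fun v => - lorentz (G v) o).
Proof.
move=> CG.
have /(class_C_mxP _ _ U_open)/(_ 0 0) :=
  class_C_mulmx U_open CG (class_C_cst d (- (eta *m o^T)) U_open).
apply: class_C_ext => // v _.
by rewrite mulmxN mxE lorentzE /dot mulmxA.
Qed.

Lemma partial_lorentz (G : 'rV[R]_m -> 'rV[R]_N.+1) k u : class_C 1 U G -> U u ->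
  partial k (fun v => - lorentz (G v) o) u = - lorentz (partial k G u) o.
Proof.
move=> CG Uu; pose c := - (eta *m o^T).
have E x : - lorentz x o = (x *m c) 0 0.
  by rewrite /c mulmxN mxE lorentzE /dot mulmxA.
rewrite E -(partial_mulmx_cst _ _ CG Uu) partial_mx; last first.
  exact: class_C_derivable (class_C_mulmx U_open CG (class_C_cst 1 c U_open)) Uu.
by apply: (partial_ext _ U_open) => // v _; rewrite E.
Qed.

(** The tangential part of the second derivatives of [F] is exactly the Christoffel
    term of the Hessian. *)
Lemma hessian_height X u : U u ->
  let H := \matrix_(i, j) (partial i (partial j height) u
             - \sum_(k < m) christoffel_mx i u j k * partial k height u) in
  (X *m H *m X^T) 0 0 = - lorentz (X *m second_form_along u X) o.
Proof.
move=> Uu H.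
have CF : class_C 2 U F by exact: class_CW.
have HE i j : H i j = - lorentz (row j (second_form u i)) o.
  rewrite mxE.
  have -> : partial i (partial j height) u = - lorentz (partial i (partial j F) u) o.
    rewrite -(partial_lorentz _ (class_C_partial j CF) Uu).
    apply: (partial_ext _ U_open) => // v; rewrite inE => Uv.
    exact: (partial_lorentz _ (class_CW CF) Uv).
  have -> : row j (second_form u i) =
      partial i (partial j F) u - \sum_k christoffel_mx i u j k *: partial k F u.
    rewrite /second_form linearB /= (row_partial_frame _ _ Uu) row_mul mulmx_sum_row.
    by congr (_ - _); apply: eq_bigr => k _; rewrite row_frame [X in X *: _]mxE.
  rewrite !lorentzE dotDl dotNl opprD; congr (_ - _).
  rewrite /dot !mulmx_suml summxE -sumrN; apply: eq_bigr => k _.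
  rewrite (partial_lorentz _ (class_CW CF) Uu) mulrN lorentzE.
  by rewrite -!scalemxAl [in RHS]mxE.
rewrite second_form_along_sum lorentzE /dot !mulmx_suml summxE -sumrN.
rewrite -mulmxA mxE; apply: eq_bigr => i _.
rewrite !mulmx_suml summxE -sumrN mxE mulr_sumr; apply: eq_bigr => j _.
rewrite HE -!scalemxAl [in RHS]mxE lorentzE mxE mulNr mulrN -mulrA.
by rewrite [_ * X 0 j]mulrC mulrA.
Qed.

End Height.

End Immersion.

(** * Kaehler submanifolds of the hyperbolic space *)

Lemma posdef_unitmx (R : realType) m (g : 'M[R]_m) :
  (forall X : 'rV_m, X != 0 -> 0 < (X *m g *m X^T) 0 0) -> g \in unitmx.
Proof.
move=> g_pos; rewrite -row_free_unit -kermx_eq0; apply/negPn/negP => /rowV0Pn[X].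
move=> /sub_kermxP Xg /g_pos; by rewrite Xg mul0mx mxE ltxx.
Qed.

Lemma mx_entry (R : realType) m q (A : 'M[R]_(m, q)) i j :
  ((delta_mx 0 i : 'rV_m) *m A *m (delta_mx 0 j : 'rV_q)^T) 0 0 = A i j.
Proof. by rewrite -rowE trmx_delta -colE !mxE. Qed.

Lemma arcosh_lt (R : realType) (a r : R) : arcosh a < r -> a <= expR r.
Proof.
move=> ar; have sq0 := sqrtr_ge0 (a ^+ 2 - 1).
have [s0|s0] := ltP 0 (a + Num.sqrt (a ^+ 2 - 1)).
  have : a + Num.sqrt (a ^+ 2 - 1) < expR r.
    by rewrite -[ltLHS]lnK ?posrE // ltr_expR.
  lra.
(* Outside the domain of [ln] the hypothesis says nothing, but then [a <= 0]. *)
have := expR_gt0 r; lra.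
Qed.

Lemma isometric_immersion_partial (R : realType) (m N : nat)
    (M : riemannianManifold R m) (f : M -> hyperbolic R N) a u i j :
  isometric_immersion f -> cod (atlas a) u ->
  let F v := ambient (f (param (atlas a) v)) in
  lorentz (partial i F u) (partial j F u) = gram a u i j.
Proof.
move=> hf Uu F; have [_ iso] := hf a.
by rewrite [LHS](iso u _ _ Uu) /metric mx_entry.
Qed.

Lemma cplx_gram (R : realType) (n : nat) (M : kaehlerManifold R n)
    (a : atlas_index M) u : cod (atlas a) u ->
  cplx a u *m gram a u *m (cplx a u)^T = gram a u.
Proof.
move=> Uu; apply/matrixP => i j; rewrite -[LHS]mx_entry -[RHS]mx_entry.
have := cplx_orthogonal (delta_mx 0 i) (delta_mx 0 j) Uu.
by rewrite /metric trmx_mul !mulmxA.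
Qed.

Lemma cplx_parallel_mx (R : realType) (n : nat) (M : kaehlerManifold R n)
    (a : atlas_index M) k u : cod (atlas a) u ->
  partial k (cplx a) u =
    christoffel_mx (gram a) k u *m cplx a u - cplx a u *m christoffel_mx (gram a) k u.
Proof.
move=> Uu; apply/matrixP => i j.
have := cplx_parallel k i j Uu; rewrite /nabla_endo sumrB.
move/eqP; rewrite addr_eq0 opprB => /eqP ->.
rewrite [RHS]mxE [X in _ = _ + X]mxE !mxE.
by congr (_ - _); apply: eq_bigr => l _; rewrite mxE.
Qed.

Lemma hyperbolic_future (R : realType) (N : nat) (x : hyperbolic R N) :
  lorentz x x = -1 /\ 0 < (x : 'rV_N.+1) 0 0.
Proof. by case: x. Qed.

Theorem theorem4 (R : realType) (n p : nat) (hp2 : (2 <= p)%N)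
    (hpn : (p <= n - 2)%N) (M : kaehlerManifold R n)
    (f : M -> hyperbolic R (2 * n + p)) (hf : isometric_immersion f)
    (hM : weak_maximum_principle_hessian M) :
  unbounded (range f).
Proof.
case=> ctr [rad sub_ball].
pose h (x : M) : R := - lorentz (f x) ctr.
have h_le x : h x <= expR rad.
  have := sub_ball (f x) (ex_intro2 _ _ x I erefl).
  rewrite /geodesic_ball /= /hyperbolic_dist lorentzC; exact: arcosh_lt.
have h_C2 : C2_function h.
  move=> a; have [smoothF _] := hf a.
  have U_open : open (cod (atlas a)) by exact: cod_open.
  exact: (class_C_lorentz U_open ctr (smoothF 2)).
have h_bounded : has_ubound (range h).
  by exists (expR rad) => _ [x _ <-]; exact: h_le.
have [x x_max] := hM h h_C2 h_bounded.
(* Any [k > 2 expR rad] contradicts the final estimate [k <= 2 expR rad]. *)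
pose k := Num.bound (2 * expR rad).
have k_gt : 2 * expR rad < k%:R.
  by apply: archi_boundP; rewrite mulr_ge0 // expR_ge0.
have k0 : (0 < k)%N.
  by rewrite -(ltr_nat R); apply: le_lt_trans k_gt; rewrite mulr_ge0 // expR_ge0.
have [_ hess_le] := x_max k k0.
have [a dom_x] := atlas_cover (x k).
set u := Defs.coord (atlas a) (x k).
have Uu : cod (atlas a) u by exact: coord_cod.
have {}hess_le X := hess_le a dom_x X; rewrite /= -/u in hess_le.
pose F v := ambient (f (param (atlas a) v)).
pose U := cod (atlas a); pose g := gram a; pose J := cplx a.
have U_open : open U by exact: cod_open.
have F_class : class_C 3 U F by have [smoothF _] := hf a; exact: smoothF.
have F_iso v i j : U v -> lorentz (partial i F v) (partial j F v) = g v i j.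
  exact: isometric_immersion_partial.
have g_unit v : U v -> g v \in unitmx.
  by move=> Uv; apply: posdef_unitmx => X; exact: gram_posdef.
have F_norm v : U v -> lorentz (F v) (F v) = -1.
  by move=> _; have [] := hyperbolic_future (f (param (atlas a) v)).
have J2 v : U v -> J v *m J v = - 1%:M by exact: cplx_square.
have [|W W0 /= Wnull] := exists_null_direction U_open F_class F_iso g_unit
  (cplx_smooth a 2) J2 (@cplx_gram _ _ M a) (@cplx_parallel_mx _ _ M a) Uu.
  by lia.
set b := _ + _ in Wnull.
pose G := (W *m g u *m W^T) 0 0.
have G0 : 0 < G by exact: gram_posdef.
have GJ : (W *m J u *m g u *m (W *m J u)^T) 0 0 = G.
  exact: (cplx_orthogonal W W Uu).
(* The position component of [b] is determined by the metric: [b] is a nonzero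
   null vector that points to the future. *)
have b_position : lorentz b (F u) = - (2 * G).
  rewrite /b lorentzE dotDl -!lorentzE.
  rewrite !(second_form_along_position U_open F_class F_iso _ F_norm Uu).
  by rewrite GJ -/G; ring.
have hessE X : (X *m hessian h a u *m X^T) 0 0 =
    - lorentz (X *m second_form_along F g u X) ctr.
  rewrite -(hessian_height g U_open F_class ctr X Uu) /=.
  congr ((_ *m _ *m _) 0 0); apply/matrixP => i j; rewrite [LHS]mxE [RHS]mxE.
  by congr (_ - _); apply: eq_bigr => l _; rewrite [in RHS]mxE.
have b_height : - lorentz b ctr <= k%:R^-1 * (2 * G).
  rewrite /b lorentzE dotDl -!lorentzE opprD.
  have := lerD (hess_le W) (hess_le (W *m J u)).
  by rewrite !hessE /metric GJ -/G -mulrDr mulr2n mulrDl mul1r.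
have [norm_o o0] := hyperbolic_future ctr.
have [x_norm x0] := hyperbolic_future (f (param (atlas a) u)).
have bx_lt0 : lorentz b (F u) < 0 by rewrite b_position oppr_lt0 mulr_gt0.
have obs : - lorentz ctr (F u) <= expR rad by rewrite lorentzC; exact: h_le.
have := null_observer_bound x_norm x0 norm_o o0 (expR_gt0 rad) obs Wnull bx_lt0.
rewrite b_position opprK => G_le.
have kR0 : 0 < k%:R :> R by rewrite ltr0n.
have : 2 * G < 2 * G.
  apply: le_lt_trans G_le _.
  apply: (@le_lt_trans _ _ (2 * expR rad * (k%:R^-1 * (2 * G)))).
    by rewrite ler_wpM2l // mulr_ge0 // expR_ge0.
  by rewrite mulrA gtr_pMl ?mulr_gt0 // ltr_pdivrMr ?mul1r.
by rewrite ltxx.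
Qed.
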